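(* Let $G$ be a finite group and let $n=i+j$ with $i,j\ge 0$. The transfer product $\star\colon A(G\wr\Sigma_i)\otimes A(G\wr\Sigma_j)\to A(G\wr\Sigma_n)$ restricts to a transfer product \[\star\colon \mathring{A}(G,i)\otimes\mathring{A}(G,j)\to\mathring{A}(G,n).\]
   Context: For a finite group $\Gamma$, $A(\Gamma)$ is the Burnside ring: the Grothendieck ring of isomorphism classes $[X]$ of finite $\Gamma$-sets under disjoint union and Cartesian product. Its canonical $\mathbb{Z}$-basis consists of the isomorphism classes of transitive $\Gamma$-sets. $G\wr\Sigma_n=G^{\times n}\rtimes\Sigma_n$ with multiplication $(\bar g,\sigma)(\bar h,\tau)=(\bar g\,\sigma\bar h,\sigma\tau)$, $(\sigma\bar h)_i=\bar h_{\sigma^{-1}(i)}$. If $X$ is a left $G$-set, $G\wr\Sigma_n$ acts on $X^{\times n}$ by $((\bar g,\sigma)x)_i=\bar g_i x_{\sigma^{-1}(i)}$. For $n=i+j$ the transfer product $\star$ is induced by $X\star Y=(G\wr\Sigma_n)\times_{G\wr\Sigma_i\times G\wr\Sigma_j}(X\times Y)$, for $X$ a finite $G\wr\Sigma_i$-set and $Y$ a finite $G\wr\Sigma_j$-set, using a standard embedding $G\wr\Sigma_i\times G\wr\Sigma_j\subseteq G\wr\Sigma_n$. The total power operations $\mathbb{P}_n\colon A(G)\to A(G\wr\Sigma_n)$, $n\ge0$, are the unique functions with $\mathbb{P}_n([X])=[X^{\times n}]$ for finite $G$-sets $X$, $\mathbb{P}_0=1$ constantly, and $\mathbb{P}_n(x+y)=\sum_{i+j=n}\mathbb{P}_i(x)\star\mathbb{P}_j(y)$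 for all $x,y\in A(G)$. $\mathring{A}(G,n)\subseteq A(G\wr\Sigma_n)$ is the additive summand spanned by the smallest subset of the canonical basis of $A(G\wr\Sigma_n)$ whose span contains the image of $\mathbb{P}_n\colon A(G)\to A(G\wr\Sigma_n)$. *)

(* Defs.v *)
From HB Require Import structures.
From mathcomp Require Import all_boot all_order all_algebra all_fingroup.
From mathcomp Require Import generic_quotient.
From mathcomp Require Import boolp classical_sets.

Set Implicit Arguments.
Unset Strict Implicit.
Unset Printing Implicit Defensive.

Import GRing.Theory.

Local Open Scope ring_scope.
Local Open Scope quotient_scope.

(******************************************************************************)
(*   groth S == the Grothendieck group of a commutative monoid S, which is a  *)
(*              commutative ring when S is a commutative semiring; its        *)
(*              elements are the formal differences gdiff a b                 *)
(*   groth_bilin f == the biadditive extension to Grothendieck groups of a    *)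
(*              biadditive f : S -> T -> U                                    *)
(*   gset H == finite left H-sets, for H : finGroupType                       *)
(*   isocls H == the semiring of isomorphism classes of finite H-sets         *)
(*   burnside H == the Burnside ring of H; bcls X is the class [X] in it      *)
(*   wreath G n == G wr Sigma_n                                               *)
(*   ind phi Z == H x_K Z, for phi : K -> H a group morphism and Z a K-set    *)
(*   star e x y == the transfer product, where e : n = (i + j)%N              *)
(*   total_power P <-> P is the family of total power operations of G         *)
(*   zspan S == the additive subgroup spanned by S                            *)
(*   Aring P n == the span, in A(G wr Sigma_n), of the smallest set of        *)
(*              canonical basis elements whose span contains the image of P n *)
(******************************************************************************)

Section GrothendieckGroup.

Variable S : nmodType.

Definition groth_eq (p q : S * S) : bool :=
  `[< exists z, p.1 + q.2 + z = q.1 + p.2 + z >].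

Lemma groth_eq_refl : reflexive groth_eq.
Proof. by move=> p; apply/asboolP; exists 0. Qed.

Lemma groth_eq_sym : symmetric groth_eq.
Proof.
by move=> p q; apply/asboolP/asboolP => -[z Hz]; exists z; rewrite Hz.
Qed.

Lemma groth_eq_trans : transitive groth_eq.
Proof.
move=> q p r /asboolP[z Hz] /asboolP[w Hw]; apply/asboolP.
exists (q.2 + z + w).
have -> : p.1 + r.2 + (q.2 + z + w) = (p.1 + q.2 + z) + (r.2 + w).
  by rewrite (AC (2*3) ((1*3*4)*(2*5)))/=.
rewrite Hz.
have -> : q.1 + p.2 + z + (r.2 + w) = (q.1 + r.2 + w) + (p.2 + z).
  by rewrite (AC (3*2) ((1*4*5)*(2*3)))/=.
by rewrite Hw (AC (3*2) ((1*4)*(2*5*3)))/=.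
Qed.

Canonical groth_equiv :=
  EquivRel groth_eq groth_eq_refl groth_eq_sym groth_eq_trans.

Definition groth : Type := {eq_quot groth_equiv}.
HB.instance Definition _ := Choice.on groth.
HB.instance Definition _ := EqQuotient.on groth.

Definition gdiff (a b : S) : groth := \pi_groth (a, b).

Lemma gdiffP (a b c d : S) :
  gdiff a b = gdiff c d <-> exists z, a + d + z = c + b + z.
Proof.
split; first by move/eqP; rewrite eqmodE => /asboolP.
by move=> H; apply/eqP; rewrite eqmodE; apply/asboolP.
Qed.

Lemma gdiff_repr (x : groth) : gdiff (repr x).1 (repr x).2 = x.
Proof. by rewrite /gdiff -surjective_pairing reprK. Qed.

Lemma groth_ind (Q : groth -> Prop) :
  (forall a b, Q (gdiff a b)) -> forall x, Q x.
Proof. by move=> H x; rewrite -(gdiff_repr x). Qed.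

Definition gadd (x y : groth) : groth :=
  gdiff ((repr x).1 + (repr y).1) ((repr x).2 + (repr y).2).
Definition gopp (x : groth) : groth := gdiff (repr x).2 (repr x).1.

Lemma gaddE a b c d : gadd (gdiff a b) (gdiff c d) = gdiff (a + c) (b + d).
Proof.
rewrite /gadd.
move: (gdiff_repr (gdiff a b)) (gdiff_repr (gdiff c d)).
case: (repr (gdiff a b)) => p1 p2; case: (repr (gdiff c d)) => q1 q2 /=.
move=> /gdiffP[z Hz] /gdiffP[w Hw]; apply/gdiffP; exists (z + w).
rewrite (AC (2*2*2) ((1*3*5)*(2*4*6)))/= Hz Hw.
by rewrite (AC (3*3) ((1*4)*(2*5)*(3*6))).
Qed.

Lemma goppE a b : gopp (gdiff a b) = gdiff b a.
Proof.
rewrite /gopp.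
move: (gdiff_repr (gdiff a b)); case: (repr (gdiff a b)) => p1 p2 /=.
move=> /gdiffP[z Hz]; apply/gdiffP; exists z.
by rewrite (addrC p2) (addrC b) Hz.
Qed.

Lemma gaddA : associative gadd.
Proof.
elim/groth_ind=> a b; elim/groth_ind=> c d; elim/groth_ind=> e f.
by rewrite !gaddE !addrA.
Qed.

Lemma gaddC : commutative gadd.
Proof.
elim/groth_ind=> a b; elim/groth_ind=> c d.
by rewrite !gaddE (addrC a) (addrC b).
Qed.

Lemma gadd0 : left_id (gdiff 0 0) gadd.
Proof. by elim/groth_ind=> a b; rewrite gaddE !add0r. Qed.

Lemma gaddN : left_inverse (gdiff 0 0) gopp gadd.
Proof.
elim/groth_ind=> a b; rewrite goppE gaddE; apply/gdiffP; exists 0.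
by rewrite !addr0 !add0r addrC.
Qed.

HB.instance Definition _ := GRing.isZmodule.Build groth gaddA gaddC gadd0 gaddN.

Lemma gdiffD a b c d : gdiff a b + gdiff c d = gdiff (a + c) (b + d).
Proof. exact: gaddE. Qed.

Lemma gdiffN a b : - gdiff a b = gdiff b a.
Proof. exact: goppE. Qed.

Lemma gdiffB a b : gdiff a b = gdiff a 0 - gdiff b 0.
Proof. by rewrite gdiffN gdiffD addr0 add0r. Qed.

End GrothendieckGroup.

Section BiadditiveExtension.

Variables (S T U : nmodType) (f : S -> T -> U).

(* The extension takes [a - b] and [c - d] to                                 *)
(* [(f a c + f b d) - (f a d + f b c)]; groth_bilinE shows that this does not *)
(* depend on the chosen representatives when f is biadditive.                 *)
Definition groth_bilin (x : groth S) (y : groth T) : groth U :=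
  let: (a, b) := repr x in let: (c, d) := repr y in
  gdiff (f a c + f b d) (f a d + f b c).

Hypothesis fDl : forall a b c, f (a + b) c = f a c + f b c.
Hypothesis fDr : forall a c d, f a (c + d) = f a c + f a d.

Lemma groth_bilinE a b c d :
  groth_bilin (gdiff a b) (gdiff c d) =
  gdiff (f a c + f b d) (f a d + f b c).
Proof.
rewrite /groth_bilin.
move: (gdiff_repr (gdiff a b)) (gdiff_repr (gdiff c d)).
case: (repr (gdiff a b)) => p1 p2; case: (repr (gdiff c d)) => q1 q2 /=.
move=> /gdiffP[z Hz] /gdiffP[w Hw].
transitivity (gdiff (f a q1 + f b q2) (f a q2 + f b q1)); apply/gdiffP.
- have E q : f p1 q + f b q + f z q = f a q + f p2 q + f z q.
    by rewrite -!fDl Hz.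
  exists (f z q1 + f z q2).
  rewrite (AC (2*2*2) ((1*4*5)*(3*2*6)))/= (E q1) -(E q2).
  by rewrite (AC (3*3) ((1*5)*(4*2)*(3*6)))/=.
- have E u : f u q1 + f u d + f u w = f u c + f u q2 + f u w.
    by rewrite -!fDr Hw.
  exists (f a w + f b w).
  rewrite (AC (2*2*2) ((1*3*5)*(4*2*6)))/= (E a) -(E b).
  by rewrite (AC (3*3) ((1*5)*(2*4)*(3*6)))/=.
Qed.

Lemma groth_bilinDl x y z :
  groth_bilin (x + y) z = groth_bilin x z + groth_bilin y z.
Proof.
elim/groth_ind: x => a b; elim/groth_ind: y => c d; elim/groth_ind: z => u v.
rewrite gdiffD !groth_bilinE gdiffD !fDl.
by congr gdiff; rewrite (AC (2*2) ((1*3)*(2*4))).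
Qed.

Lemma groth_bilinDr x y z :
  groth_bilin x (y + z) = groth_bilin x y + groth_bilin x z.
Proof.
elim/groth_ind: x => a b; elim/groth_ind: y => c d; elim/groth_ind: z => u v.
rewrite gdiffD !groth_bilinE gdiffD !fDr.
by congr gdiff; rewrite (AC (2*2) ((1*3)*(2*4))).
Qed.

End BiadditiveExtension.

Section GrothendieckRing.

Variable S : comPzSemiRingType.

Notation gmul := (groth_bilin (@GRing.mul S)).

Let gmulE a b c d :
  gmul (gdiff a b) (gdiff c d) = gdiff (a * c + b * d) (a * d + b * c).
Proof. by apply: groth_bilinE; [apply: mulrDl | apply: mulrDr]. Qed.

Lemma gmulA : associative gmul.
Proof.
elim/groth_ind=> a b; elim/groth_ind=> c d; elim/groth_ind=> e f.
rewrite !gmulE !mulrDl !mulrDr !mulrA.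
by congr gdiff; rewrite (AC (2*2) ((1*4)*(2*3))).
Qed.

Lemma gmulC : commutative gmul.
Proof.
elim/groth_ind=> a b; elim/groth_ind=> c d; rewrite !gmulE.
by congr gdiff; rewrite ![_ * c]mulrC ![_ * d]mulrC // addrC.
Qed.

Lemma gmul1 : left_id (gdiff 1 0) gmul.
Proof. by elim/groth_ind=> a b; rewrite gmulE !mul1r !mul0r !addr0. Qed.

Lemma gmulDl : left_distributive gmul +%R.
Proof.
by move=> x y z; apply: groth_bilinDl; [apply: mulrDl | apply: mulrDr].
Qed.

HB.instance Definition _ :=
  GRing.Zmodule_isComPzRing.Build (groth S) gmulA gmulC gmul1 gmulDl.

End GrothendieckRing.

Section FiniteGSets.

Local Open Scope group_scope.

Variable H : finGroupType.

Record gset := GSet {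
  gcar :> finType;
  gact : H -> gcar -> gcar;
  gact1 : forall x, gact 1 x = x;
  gactM : forall g h x, gact (g * h) x = gact g (gact h x)
}.

Definition giso (X Y : gset) : Prop :=
  exists f : X -> Y,
    bijective f /\ forall (g : H) (x : X), f (gact g x) = gact g (f x).

Definition gtransitive (X : gset) : Prop :=
  exists x : X, forall y : X, exists g : H, y = gact g x.

Lemma giso_refl X : giso X X.
Proof. by exists id; split=> //; exists id. Qed.

Lemma giso_sym X Y : giso X Y -> giso Y X.
Proof.
case=> f [[f' fK f'K] fJ]; exists f'; split; first by exists f.
by move=> g y; rewrite -[y in LHS]f'K -fJ fK.
Qed.

Lemma giso_trans X Y Z : giso X Y -> giso Y Z -> giso X Z.
Proof.
case=> f [fbij fJ] [h [hbij hJ]]; exists (h \o f).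
by split=> [|g x /=]; [apply: bij_comp | rewrite fJ hJ].
Qed.

(* The finite H-sets with carrier 'I_n form a choiceType that contains every  *)
(* finite H-set up to isomorphism.                                            *)
Definition is_act n (f : {ffun H -> {ffun 'I_n -> 'I_n}}) : bool :=
  [forall x, f 1 x == x] &&
  [forall g, forall h, forall x, f (g * h) x == f g (f h x)].

Definition skel : Type := {n : nat & {f | @is_act n f}}.
HB.instance Definition _ := Choice.on skel.

Lemma skel_act1 (s : skel) x : val (tagged s) 1 x = x.
Proof. by case/andP: (valP (tagged s)) => /forallP/(_ x)/eqP. Qed.

Lemma skel_actM (s : skel) g h x :
  val (tagged s) (g * h) x = val (tagged s) g (val (tagged s) h x).
Proof.
case/andP: (valP (tagged s)) => _.
by move=> /forallP/(_ g)/forallP/(_ h)/forallP/(_ x)/eqP.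
Qed.

Definition gset_of (s : skel) : gset :=
  @GSet 'I_(tag s) (fun g x => val (tagged s) g x) (@skel_act1 s) (@skel_actM s).

Definition skel_fun (X : gset) : {ffun H -> {ffun 'I_#|X| -> 'I_#|X|}} :=
  [ffun g => [ffun i => enum_rank (gact g (enum_val i : X))]].

Lemma skel_funP X : is_act (skel_fun X).
Proof.
apply/andP; split.
  by apply/forallP=> x; rewrite !ffunE gact1 enum_valK.
apply/forallP=> g; apply/forallP=> h; apply/forallP=> x.
by rewrite !ffunE enum_rankK gactM.
Qed.

Definition skel_of (X : gset) : skel :=
  Tagged (fun n => {f | @is_act n f}) (Sub (skel_fun X) (skel_funP X)).

Lemma skel_ofK X : giso (gset_of (skel_of X)) X.
Proof.
exists (fun i : 'I_#|X| => enum_val i : X); split.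
  by exists enum_rank; [apply: enum_valK | apply: enum_rankK].
by move=> g i; rewrite /= !ffunE enum_rankK.
Qed.

Definition skel_eq (s t : skel) : bool := `[< giso (gset_of s) (gset_of t) >].

Lemma skel_eq_refl : reflexive skel_eq.
Proof. by move=> s; apply/asboolP; apply: giso_refl. Qed.

Lemma skel_eq_sym : symmetric skel_eq.
Proof. by move=> s t; apply/asboolP/asboolP => /giso_sym. Qed.

Lemma skel_eq_trans : transitive skel_eq.
Proof.
by move=> t s u /asboolP st /asboolP tu; apply/asboolP/(giso_trans st tu).
Qed.

Canonical skel_equiv := EquivRel skel_eq skel_eq_refl skel_eq_sym skel_eq_trans.

Definition isocls : Type := {eq_quot skel_equiv}.
HB.instance Definition _ := Choice.on isocls.
HB.instance Definition _ := EqQuotient.on isocls.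

Definition cls (X : gset) : isocls := \pi_isocls (skel_of X).
Definition cls_repr (c : isocls) : gset := gset_of (repr c).

Lemma clsP X Y : cls X = cls Y <-> giso X Y.
Proof.
have XE := skel_ofK X; have YE := skel_ofK Y.
split.
  move/eqP; rewrite eqmodE => /asboolP XY.
  exact: giso_trans (giso_sym XE) (giso_trans XY YE).
move=> XY; apply/eqP; rewrite eqmodE; apply/asboolP.
exact: giso_trans XE (giso_trans XY (giso_sym YE)).
Qed.

Lemma cls_reprK c : cls (cls_repr c) = c.
Proof.
rewrite /cls -[RHS]reprK; apply/eqP; rewrite eqmodE.
by apply/asboolP; apply: skel_ofK.
Qed.

Lemma cls_reprE X : giso (cls_repr (cls X)) X.
Proof. by apply/clsP; rewrite cls_reprK. Qed.

Lemma cls_ind (Q : isocls -> Prop) : (forall X, Q (cls X)) -> forall c, Q c.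
Proof. by move=> HQ c; rewrite -(cls_reprK c). Qed.

Definition gset0 : gset.
Proof. by exists void (fun _ x => x). Defined.

Definition gset1 : gset.
Proof. by exists unit (fun _ x => x). Defined.

Definition gset_sum (X Y : gset) : gset.
Proof.
exists (X + Y)%type
  (fun g u => match u with inl x => inl (gact g x) | inr y => inr (gact g y) end).
- by case=> x; rewrite gact1.
- by move=> g h [] x; rewrite gactM.
Defined.

Definition gset_prod (X Y : gset) : gset.
Proof.
exists (X * Y)%type (fun g u => (gact g u.1, gact g u.2)).
- by case=> x y; rewrite !gact1.
- by move=> g h [x y]; rewrite !gactM.
Defined.

Lemma gset_sum_iso X X' Y Y' :
  giso X X' -> giso Y Y' -> giso (gset_sum X Y) (gset_sum X' Y').
Proof.
case=> f [[f' fK f'K] fJ] [h [[h' hK h'K] hJ]].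
exists (fun u : X + Y => match u with inl x => inl (f x) | inr y => inr (h y) end).
split; last by move=> g [x|y] /=; rewrite ?fJ ?hJ.
exists (fun u : X' + Y' =>
  match u with inl x => inl (f' x) | inr y => inr (h' y) end).
- by case=> x; rewrite ?fK ?hK.
- by case=> x; rewrite ?f'K ?h'K.
Qed.

Lemma gset_prod_iso X X' Y Y' :
  giso X X' -> giso Y Y' -> giso (gset_prod X Y) (gset_prod X' Y').
Proof.
case=> f [[f' fK f'K] fJ] [h [[h' hK h'K] hJ]].
exists (fun u : X * Y => (f u.1, h u.2)).
split; last by move=> g [x y] /=; rewrite ?fJ ?hJ.
exists (fun u : X' * Y' => (f' u.1, h' u.2)).
- by case=> x y /=; rewrite fK hK.
- by case=> x y /=; rewrite f'K h'K.
Qed.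

Definition iadd (c d : isocls) : isocls :=
  cls (gset_sum (cls_repr c) (cls_repr d)).
Definition imul (c d : isocls) : isocls :=
  cls (gset_prod (cls_repr c) (cls_repr d)).

Lemma iaddE X Y : iadd (cls X) (cls Y) = cls (gset_sum X Y).
Proof. by apply/clsP/gset_sum_iso; apply: cls_reprE. Qed.

Lemma imulE X Y : imul (cls X) (cls Y) = cls (gset_prod X Y).
Proof. by apply/clsP/gset_prod_iso; apply: cls_reprE. Qed.

Lemma iaddA : associative iadd.
Proof.
elim/cls_ind=> X; elim/cls_ind=> Y; elim/cls_ind=> Z; rewrite !iaddE.
apply/clsP; exists (fun u : X + (Y + Z) => match u with
  | inl x => inl (inl x) | inr (inl y) => inl (inr y) | inr (inr z) => inr z end).
split; last by move=> g [|[]].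
exists (fun u : X + Y + Z => match u with
  | inl (inl x) => inl x | inl (inr y) => inr (inl y) | inr z => inr (inr z) end).
- by case=> [|[]].
- by case=> [[]|].
Qed.

Lemma iaddC : commutative iadd.
Proof.
elim/cls_ind=> X; elim/cls_ind=> Y; rewrite !iaddE; apply/clsP.
exists (fun u : X + Y => match u with inl x => inr x | inr y => inl y end).
split; last by move=> g [].
by exists (fun u : Y + X => match u with inl x => inr x | inr y => inl y end); case.
Qed.

Lemma iadd0 : left_id (cls gset0) iadd.
Proof.
elim/cls_ind=> X; rewrite !iaddE; apply/clsP.
exists (fun u : void + X => match u with inl x => match x with end | inr y => y end).
split; last by move=> g [].
by exists (fun x : X => inr x : void + X); [case | ].
Qed.

Lemma imulA : associative imul.
Proof.
elim/cls_ind=> X; elim/cls_ind=> Y; elim/cls_ind=> Z; rewrite !imulE.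
apply/clsP; exists (fun u : X * (Y * Z) => (u.1, u.2.1, u.2.2)).
split=> //; exists (fun u : X * Y * Z => (u.1.1, (u.1.2, u.2))).
- by case=> [? []].
- by case=> [[]].
Qed.

Lemma imulC : commutative imul.
Proof.
elim/cls_ind=> X; elim/cls_ind=> Y; rewrite !imulE; apply/clsP.
exists (fun u : X * Y => (u.2, u.1)); split=> //.
by exists (fun u : Y * X => (u.2, u.1)); case.
Qed.

Lemma imul1 : left_id (cls gset1) imul.
Proof.
elim/cls_ind=> X; rewrite !imulE; apply/clsP.
exists (fun u : unit * X => u.2); split=> //.
by exists (fun x : X => (tt, x)); [case=> [[]] | ].
Qed.

Lemma imul0 : left_zero (cls gset0) imul.
Proof.
elim/cls_ind=> X; rewrite !imulE; apply/clsP.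
exists (fun u : void * X => u.1); split=> //.
by exists (fun x : void => match x return void * X with end); case.
Qed.

Lemma imulDl : left_distributive imul iadd.
Proof.
elim/cls_ind=> X; elim/cls_ind=> Y; elim/cls_ind=> Z.
rewrite iaddE !imulE iaddE; apply/clsP.
exists (fun u : (X + Y) * Z => match u.1 with
  | inl x => inl (x, u.2) | inr y => inr (y, u.2) end).
split; last by move=> g [[]].
exists (fun u : X * Z + Y * Z => match u with
  | inl u => (inl u.1, u.2) | inr u => (inr u.1, u.2) end).
- by case=> [[]].
- by case=> [[]|[]].
Qed.

HB.instance Definition _ := GRing.isNmodule.Build isocls iaddA iaddC iadd0.
HB.instance Definition _ := GRing.Nmodule_isComPzSemiRing.Build isocls
  imulA imulC imul1 imulDl imul0.

Definition burnside : Type := groth isocls.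
HB.instance Definition _ := GRing.ComPzRing.on burnside.

Definition bcls (X : gset) : burnside := gdiff (cls X) 0.

Local Close Scope group_scope.
Local Open Scope ring_scope.

Lemma bcls0 : bcls gset0 = 0.
Proof. by []. Qed.

Lemma bcls1 : bcls gset1 = 1.
Proof. by []. Qed.

Lemma bclsD X Y : bcls (gset_sum X Y) = bcls X + bcls Y.
Proof. by rewrite gdiffD addr0 /bcls -iaddE. Qed.

Lemma bclsM X Y : bcls (gset_prod X Y) = bcls X * bcls Y.
Proof.
rewrite [RHS](groth_bilinE (@mulrDl _) (@mulrDr _)).
by rewrite !mulr0 mul0r !addr0 /bcls -imulE.
Qed.

Lemma bclsP X Y :
  bcls X = bcls Y <-> exists Z, giso (gset_sum X Z) (gset_sum Y Z).
Proof.
rewrite gdiffP; split=> -[].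
- elim/cls_ind=> Z; rewrite !addr0 => E; exists Z; apply/clsP.
  by rewrite -!iaddE.
- by move=> Z /clsP E; exists (cls Z); rewrite !addr0 [LHS]iaddE [RHS]iaddE.
Qed.

Lemma bcls_ind (Q : burnside -> Prop) :
  (forall X Y, Q (bcls X - bcls Y)) -> forall x, Q x.
Proof.
move=> HQ; elim/groth_ind; elim/cls_ind=> X; elim/cls_ind=> Y.
by rewrite gdiffB; apply: HQ.
Qed.

End FiniteGSets.



Section Induction.

Local Open Scope group_scope.

Variables (K H : finGroupType) (phi : UMagmaMorphism.type K H) (Z : gset K).

(* (h * phi k, z) ~ (h, k z) *)
Definition ind_eq (p q : H * Z) : bool :=
  [exists k : K, (p.1 == q.1 * phi k) && (q.2 == gact k p.2)].

Lemma ind_eqP (p q : H * Z) :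
  reflect (exists k : K, p.1 = q.1 * phi k /\ q.2 = gact k p.2) (ind_eq p q).
Proof.
apply: (iffP existsP) => -[k]; first by case/andP=> /eqP ? /eqP ?; exists k.
by case=> -> ->; exists k; rewrite !eqxx.
Qed.

Lemma ind_eq_refl : reflexive ind_eq.
Proof. by move=> p; apply/ind_eqP; exists 1; rewrite gmulf1 mulg1 gact1. Qed.

Lemma ind_eq_sym : symmetric ind_eq.
Proof.
move=> p q; apply/ind_eqP/ind_eqP => -[k [E1 E2]]; exists k^-1.
- by rewrite E1 E2 -mulgA -gmulfM mulgV gmulf1 mulg1 -gactM mulVg gact1.
- by rewrite E1 E2 -mulgA -gmulfM mulgV gmulf1 mulg1 -gactM mulVg gact1.
Qed.

Lemma ind_eq_trans : transitive ind_eq.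
Proof.
move=> q p r /ind_eqP[k [E1 E2]] /ind_eqP[l [F1 F2]]; apply/ind_eqP.
by exists (l * k); rewrite E1 F1 F2 E2 gmulfM mulgA gactM.
Qed.

Canonical ind_equiv := EquivRel ind_eq ind_eq_refl ind_eq_sym ind_eq_trans.

Definition ind_car : Type := {eq_quot ind_equiv}.
HB.instance Definition _ := Choice.on ind_car.
HB.instance Definition _ := EqQuotient.on ind_car.
HB.instance Definition _ := Finite.copy ind_car
  (can_type (@EquivQuot.ereprK _ _ _ _ _ (defaultEncModRel ind_equiv))).

Definition ind_pi (h : H) (z : Z) : ind_car := \pi_ind_car (h, z).

Lemma ind_piP h z h' z' :
  ind_pi h z = ind_pi h' z' <-> exists k, h = h' * phi k /\ z' = gact k z.
Proof.
split; first by move/eqP; rewrite eqmodE => /ind_eqP.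
by move=> E; apply/eqP; rewrite eqmodE; apply/ind_eqP.
Qed.

Lemma ind_pi_repr q : ind_pi (repr q).1 (repr q).2 = q.
Proof. by rewrite /ind_pi -surjective_pairing reprK. Qed.

Definition ind_act (g : H) (q : ind_car) : ind_car :=
  ind_pi (g * (repr q).1) (repr q).2.

Lemma ind_actE g h z : ind_act g (ind_pi h z) = ind_pi (g * h) z.
Proof.
rewrite /ind_act; move: (ind_pi_repr (ind_pi h z)).
case: (repr _) => h' z' /= /ind_piP[k [E1 E2]].
by apply/ind_piP; exists k; rewrite E1 mulgA.
Qed.

Lemma ind_act1 q : ind_act 1 q = q.
Proof. by rewrite -(ind_pi_repr q) ind_actE mul1g. Qed.

Lemma ind_actM g h q : ind_act (g * h) q = ind_act g (ind_act h q).
Proof. by rewrite -(ind_pi_repr q) !ind_actE mulgA. Qed.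

Definition ind : gset H := @GSet H ind_car ind_act ind_act1 ind_actM.

Lemma ind_giso (W : gset H) (F : H -> Z -> W) :
  (forall g h z, F (g * h) z = gact g (F h z)) ->
  (forall w, exists p : H * Z, w = F p.1 p.2) ->
  (forall h z h' z', F h z = F h' z' <-> ind_pi h z = ind_pi h' z') ->
  giso ind W.
Proof.
move=> FJ /boolp.choice[s sK] FP.
have FE h z : F (repr (ind_pi h z)).1 (repr (ind_pi h z)).2 = F h z.
  by apply/FP; rewrite ind_pi_repr.
exists (fun q : ind_car => F (repr q).1 (repr q).2); split.
  exists (fun w => ind_pi (s w).1 (s w).2).
  - by move=> q; rewrite -[RHS]ind_pi_repr; apply/FP; rewrite -sK.
  - by move=> w; rewrite FE -sK.
by move=> g q; rewrite -FJ -[LHS]/(F _ _) FE.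
Qed.

End Induction.

Arguments ind_piP {K H phi Z h z h' z'}.

Section InductionIso.

Variables (K H : finGroupType) (phi : UMagmaMorphism.type K H).

Lemma ind_iso (Z Z' : gset K) : giso Z Z' -> giso (ind phi Z) (ind phi Z').
Proof.
case=> f [[f' fK f'K] fJ].
apply: (@ind_giso _ _ _ _ (ind phi Z') (fun h z => ind_pi phi h (f z))).
- by move=> g h z; rewrite [RHS]ind_actE.
- move=> q; exists ((repr q).1, f' (repr q).2).
  by rewrite /= f'K ind_pi_repr.
- move=> h z h' z'; split=> /ind_piP[k [-> E]]; apply/ind_piP; exists k.
    by split=> //; apply: (can_inj fK); rewrite fJ.
  by rewrite E fJ.
Qed.

Lemma ind_sum (Z Z' : gset K) :
  giso (ind phi (gset_sum Z Z')) (gset_sum (ind phi Z) (ind phi Z')).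
Proof.
apply: (@ind_giso _ _ _ _ (gset_sum (ind phi Z) (ind phi Z'))
  (fun h (u : gset_sum Z Z') => match u with
     | inl z => inl (ind_pi phi h z) | inr z => inr (ind_pi phi h z) end)).
- by move=> g h [] z /=; rewrite [in RHS]ind_actE.
- case=> q; [exists ((repr q).1, inl (repr q).2) | exists ((repr q).1, inr (repr q).2)];
  by rewrite /= ind_pi_repr.
- move=> h [] z h' [] z'; split=> //.
  + by case=> /ind_piP[k [-> ->]]; apply/ind_piP; exists k.
  + by move=> /ind_piP[k [-> [->]]]; congr inl; apply/ind_piP; exists k.
  + by move=> /ind_piP[k [_ []]].
  + by move=> /ind_piP[k [_ []]].
  + by case=> /ind_piP[k [-> ->]]; apply/ind_piP; exists k.
  + by move=> /ind_piP[k [-> [->]]]; congr inr; apply/ind_piP; exists k.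
Qed.

End InductionIso.

Section ExternalProduct.

Variables K L : finGroupType.

Definition gset_ext (X : gset K) (Y : gset L) : gset (K * L)%type.
Proof.
exists (X * Y)%type (fun g u => (gact g.1 u.1, gact g.2 u.2)).
- by case=> x y; rewrite !gact1.
- by move=> [g g'] [h h'] [x y]; rewrite !gactM.
Defined.

Lemma gset_ext_iso (X X' : gset K) (Y Y' : gset L) :
  giso X X' -> giso Y Y' -> giso (gset_ext X Y) (gset_ext X' Y').
Proof.
case=> f [[f' fK f'K] fJ] [h [[h' hK h'K] hJ]].
exists (fun u : X * Y => (f u.1, h u.2)).
split; last by move=> g [x y] /=; rewrite ?fJ ?hJ.
exists (fun u : X' * Y' => (f' u.1, h' u.2)).
- by case=> x y /=; rewrite fK hK.
- by case=> x y /=; rewrite f'K h'K.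
Qed.

Lemma gset_extDl (X X' : gset K) (Y : gset L) :
  giso (gset_ext (gset_sum X X') Y) (gset_sum (gset_ext X Y) (gset_ext X' Y)).
Proof.
exists (fun u : (X + X') * Y => match u.1 with
  | inl x => inl (x, u.2) | inr x => inr (x, u.2) end).
split; last by move=> g [[]].
exists (fun u : X * Y + X' * Y => match u with
  | inl u => (inl u.1, u.2) | inr u => (inr u.1, u.2) end).
- by case=> [[]].
- by case=> [[]|[]].
Qed.

Lemma gset_extDr (X : gset K) (Y Y' : gset L) :
  giso (gset_ext X (gset_sum Y Y')) (gset_sum (gset_ext X Y) (gset_ext X Y')).
Proof.
exists (fun u : X * (Y + Y') => match u.2 with
  | inl y => inl (u.1, y) | inr y => inr (u.1, y) end).
split; last by move=> g [? []].
exists (fun u : X * Y + X * Y' => match u with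
  | inl u => (u.1, inl u.2) | inr u => (u.1, inr u.2) end).
- by case=> [? []].
- by case=> [[]|[]].
Qed.

End ExternalProduct.

Section Wreath.

Local Open Scope group_scope.

Variables (G : finGroupType).

Definition wreath (n : nat) : Type := ({ffun 'I_n -> G} * 'S_n)%type.
HB.instance Definition _ n := Finite.on (wreath n).

Section WreathGroup.

Variable n : nat.
Implicit Types x y z : wreath n.

(* In 'S_n, s * t is "s, then t", so that y.2 * x.2 is the composite of the   *)
(* functions x.2 and y.2, the product of the left action of 'S_n on 'I_n.     *)
Definition wr_mul x y : wreath n :=
  ([ffun i => x.1 i * y.1 (x.2^-1 i)], y.2 * x.2).
Definition wr_one : wreath n := ([ffun=> 1], 1).
Definition wr_inv x : wreath n := ([ffun i => (x.1 (x.2 i))^-1], x.2^-1).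

Lemma wr_mulA : associative wr_mul.
Proof.
move=> x y z; congr (_, _) => /=; last by rewrite mulgA.
by apply/ffunP=> i; rewrite !ffunE invMg permM mulgA.
Qed.

Lemma wr_mul1 : left_id wr_one wr_mul.
Proof.
case=> g s; congr (_, _) => /=; last by rewrite mulg1.
by apply/ffunP=> i; rewrite !ffunE mul1g invg1 perm1.
Qed.

Lemma wr_mulV : left_inverse wr_one wr_inv wr_mul.
Proof.
case=> g s; congr (_, _) => /=; last by rewrite mulgV.
by apply/ffunP=> i; rewrite !ffunE /= invgK mulVg.
Qed.

HB.instance Definition _ :=
  Finite_isGroup.Build (wreath n) wr_mulA wr_mul1 wr_mulV.

Lemma wr_mulE x y : x * y = ([ffun i => x.1 i * y.1 (x.2^-1 i)], y.2 * x.2).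
Proof. by []. Qed.

Definition pow_act (X : gset G) (x : wreath n) (u : {ffun 'I_n -> X}) :
    {ffun 'I_n -> X} :=
  [ffun i => gact (x.1 i) (u (x.2^-1 i))].

Lemma pow_act1 X u : @pow_act X 1 u = u.
Proof. by apply/ffunP=> i; rewrite !ffunE /= gact1 invg1 perm1. Qed.

Lemma pow_actM X x y u : @pow_act X (x * y) u = pow_act x (pow_act y u).
Proof. by apply/ffunP=> i; rewrite !ffunE /= invMg permM gactM. Qed.

Definition gset_pow (X : gset G) : gset (wreath n) :=
  @GSet (wreath n) {ffun 'I_n -> X} (@pow_act X) (@pow_act1 X) (@pow_actM X).

End WreathGroup.

Section Embedding.

Variables (n i j : nat) (e : n = (i + j)%N).

(* 'I_n is cut into its first i and its last j elements.                      *)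
Definition blk_fun (s : 'S_i) (t : 'S_j) (k : 'I_n) : 'I_n :=
  cast_ord (esym e) match split (cast_ord e k) with
    | inl a => lshift j (s a)
    | inr b => rshift i (t b)
    end.

Lemma blk_funK s t : cancel (blk_fun s t) (blk_fun s^-1 t^-1).
Proof.
move=> k; rewrite /blk_fun cast_ordKV.
case: (split_ordP (cast_ord e k)) => a Ea; apply: (canLR (cast_ordK e)); rewrite Ea.
- by rewrite (unsplitK (inl _)) permK.
- by rewrite (unsplitK (inr _)) permK.
Qed.

Definition blk_perm s t : 'S_n := perm (can_inj (blk_funK s t)).

Definition wr_embed (x : wreath i * wreath j) : wreath n :=
  ([ffun k => match split (cast_ord e k) with
     | inl a => x.1.1 a
     | inr b => x.2.1 b
     end], blk_perm x.1.2 x.2.2).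

Lemma blk_permV s t : (blk_perm s t)^-1 = blk_perm s^-1 t^-1.
Proof.
apply/permP=> k; apply: (canLR (permK _)); rewrite !permE.
by rewrite -{1}[s]invgK -{1}[t]invgK blk_funK.
Qed.

Lemma wr_embed_morphism :
  prod (wr_embed 1 = 1) {morph wr_embed : x y / x * y}.
Proof.
split.
  congr (_, _).
    by apply/ffunP=> k; rewrite !ffunE; case: split => a; rewrite /= ffunE.
  apply/permP=> k; rewrite !permE /blk_fun.
  by case: (split_ordP (cast_ord e k)) => a Ea; apply: (canLR (cast_ordK e));
     rewrite Ea /= perm1.
move=> x y; rewrite wr_mulE; congr (_, _) => /=.
  apply/ffunP=> k; rewrite !ffunE blk_permV permE /blk_fun cast_ordKV.
  case: (split_ordP (cast_ord e k)) => a _.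
  - by rewrite (unsplitK (inl _)) ffunE.
  - by rewrite (unsplitK (inr _)) ffunE.
apply/permP=> k; rewrite permM !permE /blk_fun cast_ordKV; congr cast_ord.
case: (split_ordP (cast_ord e k)) => a _.
- by rewrite (unsplitK (inl _)) permM.
- by rewrite (unsplitK (inr _)) permM.
Qed.

Lemma wr_embed_inj : injective wr_embed.
Proof.
move=> [[g s] [h t]] [[g' s'] [h' t']] [/ffunP Eg /permP Es].
have El a : cast_ord e (cast_ord (esym e) (lshift j a)) = lshift j a.
  exact: cast_ordKV.
have Er a : cast_ord e (cast_ord (esym e) (rshift i a)) = rshift i a.
  exact: cast_ordKV.
congr (_, _); congr (_, _).
- apply/ffunP=> a; move: (Eg (cast_ord (esym e) (lshift j a))).
  by rewrite !ffunE El (unsplitK (inl _)).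
- apply/permP=> a; move: (Es (cast_ord (esym e) (lshift j a))).
  rewrite !permE /blk_fun El (unsplitK (inl _)) => /cast_ord_inj.
  exact: lshift_inj.
- apply/ffunP=> a; move: (Eg (cast_ord (esym e) (rshift i a))).
  by rewrite !ffunE Er (unsplitK (inr _)).
- apply/permP=> a; move: (Es (cast_ord (esym e) (rshift i a))).
  rewrite !permE /blk_fun Er (unsplitK (inr _)) => /cast_ord_inj.
  exact: rshift_inj.
Qed.

HB.instance Definition _ :=
  isUMagmaMorphism.Build _ _ wr_embed wr_embed_morphism.

Definition gset_star (X : gset (wreath i)) (Y : gset (wreath j)) :
    gset (wreath n) :=
  ind wr_embed (gset_ext X Y).

Definition istar (c : isocls (wreath i)) (d : isocls (wreath j)) :
    isocls (wreath n) :=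
  cls (gset_star (cls_repr c) (cls_repr d)).

Lemma istarE X Y : istar (cls X) (cls Y) = cls (gset_star X Y).
Proof. by apply/clsP/ind_iso/gset_ext_iso; apply: cls_reprE. Qed.

Local Close Scope group_scope.
Local Open Scope ring_scope.

Lemma istarDl c c' d : istar (c + c') d = istar c d + istar c' d.
Proof.
elim/cls_ind: c => X; elim/cls_ind: c' => X'; elim/cls_ind: d => Y.
rewrite [_ + _]iaddE !istarE [RHS]iaddE; apply/clsP.
by apply: giso_trans (ind_sum _ _ _); apply/ind_iso/gset_extDl.
Qed.

Lemma istarDr c d d' : istar c (d + d') = istar c d + istar c d'.
Proof.
elim/cls_ind: c => X; elim/cls_ind: d => Y; elim/cls_ind: d' => Y'.
rewrite [_ + _]iaddE !istarE [RHS]iaddE; apply/clsP.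
by apply: giso_trans (ind_sum _ _ _); apply/ind_iso/gset_extDr.
Qed.

Definition star :
    burnside (wreath i) -> burnside (wreath j) -> burnside (wreath n) :=
  groth_bilin istar.

Lemma starDl x x' y : star (x + x') y = star x y + star x' y.
Proof. exact: (groth_bilinDl istarDl istarDr). Qed.

Lemma starDr x y y' : star x (y + y') = star x y + star x y'.
Proof. exact: (groth_bilinDr istarDl istarDr). Qed.

Lemma star_bcls X Y : star (bcls X) (bcls Y) = bcls (gset_star X Y).
Proof.
have i0r c : istar c 0 = 0.
  elim/cls_ind: c => X'; rewrite istarE; apply/clsP.
  exists (fun q : gset_star X' (gset0 _) => (repr q).2.2).
  split; last by move=> g q; case: (repr q).2.2.
  by exists (fun v : void => match v with end) => [q|[]]; case: (repr q).2.2.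
have i0l d : istar 0 d = 0.
  elim/cls_ind: d => Y'; rewrite istarE; apply/clsP.
  exists (fun q : gset_star (gset0 _) Y' => (repr q).2.1).
  split; last by move=> g q; case: (repr q).2.1.
  by exists (fun v : void => match v with end) => [q|[]]; case: (repr q).2.1.
by rewrite [LHS](groth_bilinE istarDl istarDr) !i0r i0l !addr0 istarE.
Qed.

End Embedding.

End Wreath.

Definition total_power (G : finGroupType)
    (P : forall n, burnside G -> burnside (wreath G n)) : Prop :=
  [/\ forall n (X : gset G), P n (bcls X) = bcls (gset_pow n X),
      forall x, P 0%N x = 1
    & forall n x y, P n (x + y) =
        \sum_(i < n.+1)
          star (esym (subnKC (leq_ord i))) (P i x) (P (n - i)%N y)].

Local Open Scope classical_set_scope.

Definition zspan (V : zmodType) (S : set V) : set V :=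
  [set x | exists (s : seq V) (c : V -> int),
     (forall b, b \in s -> S b) /\ x = \sum_(b <- s) b *~ c b].

Definition canonical_basis (H : finGroupType) : set (burnside H) :=
  [set b | exists2 X : gset H, gtransitive X & b = bcls X].

Arguments canonical_basis : clear implicits.

(* The intersection below is itself one of the sets S, because the canonical  *)
(* basis is linearly independent; it is thus the smallest of them.            *)
Definition basis_support (G : finGroupType) n
    (f : burnside G -> burnside (wreath G n)) : set (burnside (wreath G n)) :=
  \bigcap_(S in [set S | S `<=` canonical_basis (wreath G n) /\
                          range f `<=` zspan S]) S.

Definition Aring (G : finGroupType)
    (P : forall n, burnside G -> burnside (wreath G n)) (n : nat) :
    set (burnside (wreath G n)) :=
  zspan (basis_support (P n)).

Arguments Aring {G} P n _.

(* Main.v *)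
From mathcomp Require Import all_boot all_order all_algebra all_fingroup.
From mathcomp Require Import boolp classical_sets generic_quotient.
Require Import Defs.

(** Call a basis element of A(G wr Sigma_n) a power orbit when it is the class
    of an orbit of X^n for some finite G-set X. The theorem follows from two
    facts: the power orbits are exactly the basis elements that span Aring P n
    (basis_support_power), and they are closed under the transfer product
    (star_power_orbits).

    Closure is geometric. Juxtaposing i points of X and j points of Y gives a
    point of (X + Y)^(i+j), and the elements of G wr Sigma_n that carry one such
    juxtaposition to another are those of G wr Sigma_i x G wr Sigma_j, since
    they must respect which coordinates lie in X and which in Y. Hence the
    transfer product of X^i and Y^j is a G wr Sigma_n-subset of (X + Y)^n. The
    transfer product of an orbit of X^i and an orbit of Y^j is therefore a
    subset of (X + Y)^n, and it is transitive, so it is an orbit there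
    (star_embed).

    Power orbits are forced into the support because the canonical basis is
    independent: an orbit O of X^n is detected by the number of points of a set
    with the same stabilizer as a point of O, which is additive, is nonzero on
    X^n, and vanishes on every transitive set other than O (span_orbit).

    Power orbits suffice because the image of P_n lies in their span
    (power_zspan). For [X^n] this is the decomposition into orbits. For -[Y],
    the term i = 0 of P_n(0) = sum_i P_i(Y) * P_{n-i}(-Y) is P_n(-Y), because
    P_0(Y) = 1 is a unit for the transfer product (star1); so P_n(-Y) is
    expressed through the P_m(-Y) with m < n and through [Y^i]; strong induction
    on n and the closure under the transfer product conclude. The addition
    formula then handles [X] - [Y]. *)

Set Implicit Arguments.
Unset Strict Implicit.
Unset Printing Implicit Defensive.

Import GRing.Theory.

Local Open Scope ring_scope.
Local Open Scope classical_set_scope.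

(** * Integral spans *)

Section Span.

Variables (V : zmodType) (S : set V).

Lemma big_fibers (s u : seq V) (F : V -> V) :
  uniq u -> {subset s <= u} ->
  \sum_(a <- s) F a = \sum_(b <- u) \sum_(a <- s | a == b) F a.
Proof.
move=> uu su; under [RHS]eq_bigr do rewrite big_mkcond.
rewrite exchange_big /=; apply: eq_big_seq => a /su au.
rewrite -big_mkcond /=.
under eq_bigl do rewrite eq_sym.
by rewrite -big_filter (filter_pred1_uniq uu au) big_seq1.
Qed.

Lemma sum_mulz_fiber (s : seq V) (c : V -> int) (b : V) :
  \sum_(a <- s | a == b) a *~ c a = b *~ \sum_(a <- s | a == b) c a.
Proof.
elim/big_rec2: _ => [|a y1 y2 /eqP-> ->]; first by rewrite mulr0z.
by rewrite mulrzDr.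
Qed.

Lemma zspan0 : zspan S 0.
Proof. by exists [::], (fun=> 0); split=> //; rewrite big_nil. Qed.

Lemma zspan_mem b : S b -> zspan S b.
Proof.
move=> Sb; exists [:: b], (fun=> 1); split; last by rewrite big_seq1.
by move=> a; rewrite inE => /eqP->.
Qed.

(** An integral combination assigns one coefficient to each vector, while the
    list of vectors may contain repetitions; to subtract two combinations, both
    are regrouped along a common duplicate-free list, whose coefficients add up
    those of the repeated entries. *)
Lemma zspanB x y : zspan S x -> zspan S y -> zspan S (x - y).
Proof.
move=> [s [c [sS ->]]] [t [d [tS ->]]].
exists (undup (s ++ t)), (fun b => \sum_(a <- s | a == b) c a -
                                   \sum_(a <- t | a == b) d a).
split=> [b|]; first by rewrite mem_undup mem_cat => /orP[/sS|/tS].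
have [ss tt] : {subset s <= undup (s ++ t)} /\ {subset t <= undup (s ++ t)}.
  by split=> b bs; rewrite mem_undup mem_cat bs ?orbT.
rewrite (big_fibers _ (undup_uniq _) ss) (big_fibers _ (undup_uniq _) tt).
rewrite -sumrB; apply: eq_bigr => b _.
by rewrite !sum_mulz_fiber mulrzBr.
Qed.

Lemma zspanD x y : zspan S x -> zspan S y -> zspan S (x + y).
Proof.
move=> Sx Sy; rewrite -[y]opprK; apply: zspanB => //.
by rewrite -[- y]sub0r; apply: zspanB => //; apply: zspan0.
Qed.

Lemma zspan_sum (I : Type) (r : seq I) (Q : pred I) (F : I -> V) :
  (forall k, Q k -> zspan S (F k)) -> zspan S (\sum_(k <- r | Q k) F k).
Proof.
by move=> SF; elim/big_ind: _ => //; [apply: zspan0 | apply: zspanD].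
Qed.

Lemma zspan_ind (Q : V -> Prop) :
  (forall b, S b -> Q b) -> Q 0 -> (forall x y, Q x -> Q y -> Q (x - y)) ->
  forall x, zspan S x -> Q x.
Proof.
move=> QS Q0 QB x [s [c [sS ->]]].
have QN a : Q a -> Q (- a) by move=> Qa; rewrite -sub0r; apply: QB.
have QD a b : Q a -> Q b -> Q (a + b).
  by move=> Qa Qb; rewrite -[b]opprK; apply/QB/QN.
have QM a k : Q a -> Q (a *+ k).
  by move=> Qa; elim: k => // k IH; rewrite mulrS; apply: QD.
rewrite big_seq; elim/big_ind: _ => // b /sS/QS Qb.
by case: (c b) => k; [apply: QM | apply/QN/QM].
Qed.

End Span.

Lemma zspan_sub (V : zmodType) (S S' : set V) :
  S `<=` S' -> zspan S `<=` zspan S'.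
Proof. by move=> SS x [s [c [sS ->]]]; exists s, c; split=> // b /sS/SS. Qed.

Lemma zspan_bilin (U V W : zmodType) (f : U -> V -> W)
    (S : set U) (T : set V) (R : set W) :
  (forall x x' y, f (x + x') y = f x y + f x' y) ->
  (forall x y y', f x (y + y') = f x y + f x y') ->
  (forall a b, S a -> T b -> zspan R (f a b)) ->
  forall x y, zspan S x -> zspan T y -> zspan R (f x y).
Proof.
move=> fDl fDr fST x y Sx Ty.
have fl0 z : f 0 z = 0 by apply: (addIr (f 0 z)); rewrite -fDl !add0r.
have fr0 z : f z 0 = 0 by apply: (addIr (f z 0)); rewrite -fDr !add0r.
have fBl z z' w : f (z - z') w = f z w - f z' w.
  by apply: (addIr (f z' w)); rewrite -fDl !subrK.
have fBr z w w' : f z (w - w') = f z w - f z w'.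
  by apply: (addIr (f z w')); rewrite -fDr !subrK.
move: x Sx; apply: zspan_ind => [a Sa||x x' Hx Hx'].
- move: y Ty; apply: zspan_ind => [b Tb||y y' Hy Hy'].
  + exact: fST.
  + by rewrite fr0; apply: zspan0.
  + by rewrite fBr; apply: zspanB.
- by rewrite fl0; apply: zspan0.
- by rewrite fBl; apply: zspanB.
Qed.

(** * Additive maps out of a Grothendieck group *)

Section GrothendieckLift.

Variables (S : nmodType) (V : zmodType) (f : S -> V).
Hypothesis fD : forall a b, f (a + b) = f a + f b.

Definition groth_lift (x : groth S) : V := f (repr x).1 - f (repr x).2.

Lemma groth_liftE a b : groth_lift (gdiff a b) = f a - f b.
Proof.
rewrite /groth_lift; move: (gdiff_repr (gdiff a b)).
case: (repr _) => p q /= /gdiffP[z /(congr1 f)]; rewrite !fD => /addIr E.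
by apply/eqP; rewrite subr_eq addrAC eq_sym subr_eq E.
Qed.

Lemma groth_liftB x y : groth_lift (x - y) = groth_lift x - groth_lift y.
Proof.
elim/groth_ind: x => a b; elim/groth_ind: y => c d.
rewrite gdiffN gdiffD !groth_liftE !fD !opprD opprK.
by rewrite addrACA [- f c + f d]addrC.
Qed.

End GrothendieckLift.

(** * Orbits, and independence of the canonical basis *)

Section Orbits.

Variable H : finGroupType.
Implicit Types X Y Z O : gset H.

Lemma gactK X (g : H) : cancel (@gact H X g) (gact g^-1%g).
Proof. by move=> x; rewrite -gactM mulVg gact1. Qed.

Lemma gactKV X (g : H) : cancel (@gact H X g^-1%g) (gact g).
Proof. by move=> x; rewrite -gactM mulgV gact1. Qed.

Lemma gtransitive_gen X (x y : X) :
  gtransitive X -> exists g : H, y = gact g x.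
Proof.
case=> z zX; have [g ->] := zX x; have [h ->] := zX y.
by exists (h * g^-1)%g; rewrite -gactM mulgKV.
Qed.

Definition gembed X Y : Prop :=
  exists f : X -> Y,
    injective f /\ forall (g : H) (x : X), f (gact g x) = gact g (f x).

Lemma gembed_trans X Y Z : gembed X Y -> gembed Y Z -> gembed X Z.
Proof.
case=> f [fI fJ] [h [hI hJ]]; exists (h \o f).
by split=> [|g x /=]; [apply: inj_comp | rewrite fJ hJ].
Qed.

Definition same_stab X Y (x : X) (y : Y) : bool :=
  [forall g : H, (gact g x == x) == (gact g y == y)].

Lemma same_stabP X Y (x : X) (y : Y) :
  reflect (forall g : H, (gact g x == x) = (gact g y == y)) (same_stab x y).
Proof. by apply: (iffP forallP) => E g; [exact: (eqP (E g)) | rewrite E]. Qed.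

Lemma same_stab_inj X Y Z (f : X -> Z) (x : X) (y : Y) :
  injective f -> (forall (g : H) x', f (gact g x') = gact g (f x')) ->
  same_stab (f x) y = same_stab x y.
Proof.
by move=> fI fJ; apply: eq_forallb => g; rewrite -fJ (inj_eq fI).
Qed.

(** Both sets are the quotient of H by the common stabilizer. *)
Lemma same_stab_iso X Y (x : X) (y : Y) :
  gtransitive X -> gtransitive Y -> same_stab x y -> giso X Y.
Proof.
move=> tX tY /same_stabP xy.
have D Z (z : Z) g h : (gact g z == gact h z) = (gact (h^-1 * g)%g z == z).
  by rewrite gactM (can2_eq (@gactKV Z h) (@gactK Z h)).
have E g h : gact g x = gact h x <-> gact g y = gact h y.
  by split=> /eqP gh; apply/eqP; move: gh; rewrite !D xy.
have [s sK] := boolp.choice (fun x' => gtransitive_gen x x' tX).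
have [t tK] := boolp.choice (fun y' => gtransitive_gen y y' tY).
exists (fun x' => gact (s x') y); split.
  exists (fun y' => gact (t y') x) => [x'|y'].
    by rewrite [RHS]sK; apply/E; rewrite -tK.
  by rewrite [RHS]tK; apply/E; rewrite -sK.
by move=> g x'; rewrite -gactM; apply/E; rewrite gactM -!sK.
Qed.

(** For transitive O this is the multiplicity of O as an orbit of X, times the
    cardinal of O. Counting points rather than orbits makes additivity
    immediate. *)
Definition mark O X : nat := \sum_(x : X) [exists o : O, same_stab x o].

Lemma mark_iso O X Y : giso X Y -> mark O X = mark O Y.
Proof.
case=> f [fbij fJ]; rewrite /mark [RHS](reindex f) /=; last exact: onW_bij.
apply: eq_bigr => x _; congr (nat_of_bool _); apply: eq_existsb => o.
by rewrite same_stab_inj //; apply: bij_inj.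
Qed.

Lemma mark_sum O X Y : mark O (gset_sum X Y) = (mark O X + mark O Y)%N.
Proof.
by rewrite /mark big_sumType.
Qed.

Lemma mark_neq0 O X : gtransitive O -> gembed O X -> mark O X != 0%N.
Proof.
case=> o _ [f [fI fJ]]; rewrite /mark (bigD1 (f o)) //=.
suff -> : [exists o' : O, same_stab (f o) o'] by [].
apply/existsP; exists o; move: (same_stab_inj o o fI fJ) => ->.
by apply/same_stabP.
Qed.

Lemma mark_transitive O X :
  gtransitive O -> gtransitive X -> ~ giso X O -> mark O X = 0%N.
Proof.
move=> tO tX XO; apply: big1 => x _.
case: existsP => // -[o] /(same_stab_iso tX tO) //.
Qed.

(** The coordinate functional of the canonical basis at O, up to a nonzero
    factor. *)
Definition bmark O : burnside H -> int :=
  groth_lift (fun c => (mark O (cls_repr c))%:Z).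

Lemma mark_cls_reprD O (c d : isocls H) :
  (mark O (cls_repr (c + d)))%:Z =
  (mark O (cls_repr c))%:Z + (mark O (cls_repr d))%:Z.
Proof. by rewrite (mark_iso _ (cls_reprE _)) mark_sum PoszD. Qed.

Lemma bmark_bcls O X : bmark O (bcls X) = mark O X.
Proof.
rewrite /bmark groth_liftE; last exact: mark_cls_reprD.
by rewrite !(mark_iso _ (cls_reprE _)) [mark O (gset0 H)]big1 ?subr0.
Qed.

Lemma bmarkB O x y : bmark O (x - y) = bmark O x - bmark O y.
Proof. by apply: groth_liftB => c d; apply: mark_cls_reprD. Qed.

(** If bcls O were missing from S, the functional bmark O would vanish on S, but
    not on bcls X. *)
Lemma span_orbit (S : set (burnside H)) O X :
  S `<=` canonical_basis H -> zspan S (bcls X) ->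
  gtransitive O -> gembed O X -> S (bcls O).
Proof.
move=> Sb SX tO OX; apply: contrapT => SO.
suff: bmark O (bcls X) = 0.
  by move/eqP; rewrite bmark_bcls eqz_nat (negPf (mark_neq0 tO OX)).
move: (bcls X) SX; apply: zspan_ind => [b Hb||x y Ex Ey].
- have [Y tY bY] := Sb b Hb; rewrite bY bmark_bcls mark_transitive //.
  move=> YO; apply: SO; suff -> : bcls O = b by [].
  by rewrite bY /bcls; congr gdiff; apply/clsP/giso_sym.
- by rewrite -[0 in LHS](subrr (bcls (gset0 H))) bmarkB subrr.
- by rewrite bmarkB Ex Ey subrr.
Qed.

Section InvariantSubset.

Variables (X : gset H) (A : pred X).
Hypothesis AJ : forall (g : H) x, A x -> A (gact g x).

Definition gsub : gset H.
Proof.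
exists {x : X | A x}
  (fun g (u : {x : X | A x}) => Sub (gact g (val u)) (AJ g (valP u))).
- by move=> u; apply: val_inj; rewrite /= gact1.
- by move=> g h u; apply: val_inj; rewrite /= gactM.
Defined.

Lemma gsub_embed : gembed gsub X.
Proof. by exists (fun u : gsub => val u); split=> //; apply: val_inj. Qed.

End InvariantSubset.

(** An invariant subset of X and its complement cut X into two H-sets. *)
Lemma gsub_split X (A : pred X)
    (AJ : forall (g : H) x, A x -> A (gact g x))
    (CJ : forall (g : H) x, predC A x -> predC A (gact g x)) :
  giso (gset_sum (gsub AJ) (gsub CJ)) X.
Proof.
exists (fun u : gsub AJ + gsub CJ =>
  match u with inl x => val x | inr x => val x end).
split; last by move=> g [].
apply: inj_card_bij.
  case=> [[x Ax]|[x Ax]] [[y Ay]|[y Ay]] //= E.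
  - by congr inl; apply: val_inj.
  - by case/negP: (Ay); rewrite /= -E.
  - by case/negP: (Ax); rewrite /= E.
  - by congr inr; apply: val_inj.
by rewrite card_sum !card_sig cardC.
Qed.

Lemma bcls_iso X Y : giso X Y -> bcls X = bcls Y.
Proof. by move=> XY; rewrite /bcls; congr gdiff; apply/clsP. Qed.

(** By induction on the cardinal of X, splitting off one orbit. *)
Lemma bcls_orbits X :
  zspan [set b | exists O, [/\ gtransitive O, gembed O X & b = bcls O]]
    (bcls X).
Proof.
have [m] := ubnP #|X|; elim: m => // m IH in X *; rewrite ltnS => Xm.
have [X0|/card_gt0P[x _]] := posnP #|X|.
  suff -> : bcls X = bcls (gset0 H) by apply: zspan0.
  apply: bcls_iso; have X0' (x : X) : False by have := card0_eq X0 x.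
  exists (fun x => False_rect void (X0' x)); split; last first.
    by move=> g x; case: X0'.
  by exists (fun v : gset0 H => match v with end) => [x|[]]; case: X0'.
pose A : pred X := fun y => [exists g : H, y == gact g x].
have AE (g : H) y : A (gact g y) = A y.
  apply/existsP/existsP => -[h /eqP E].
    by exists (g^-1 * h)%g; rewrite gactM -E gactK.
  by exists (g * h)%g; rewrite gactM -E.
have AJ (g : H) y : A y -> A (gact g y) by rewrite AE.
have CJ (g : H) y : predC A y -> predC A (gact g y) by rewrite /predC /= AE.
have Ax : A x by apply/existsP; exists 1%g; rewrite gact1.
rewrite -(bcls_iso (gsub_split AJ CJ)) bclsD; apply: zspanD.
  apply: zspan_mem; exists (gsub AJ); split=> //; last exact: gsub_embed.
  exists (exist _ x Ax) => -[y Ay]; have /existsP[g /eqP E] := Ay.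
  by exists g; apply: val_inj.
have lt : (#|gsub CJ| < m)%N.
  apply: leq_trans Xm; rewrite card_sig -(cardC A) -add1n leq_add2r.
  by apply/card_gt0P; exists x.
apply: zspan_sub (IH _ lt) => b [O [tO OC ->]]; exists O; split=> //.
exact: gembed_trans OC (gsub_embed _).
Qed.

End Orbits.

(** * Orbits of powers and the transfer product *)

Section PowerOrbits.

Variable G : finGroupType.

Definition power_orbits n : set (burnside (wreath G n)) :=
  [set b | exists (X : gset G) (O : gset (wreath G n)),
     [/\ gtransitive O, gembed O (gset_pow n X) & b = bcls O]].
Arguments power_orbits : clear implicits.

Lemma ind_transitive (K H : finGroupType) (phi : UMagmaMorphism.type K H)
    (Z : gset K) : gtransitive Z -> gtransitive (ind phi Z).
Proof.
case=> z zZ; exists (ind_pi phi 1%g z) => q; rewrite -(ind_pi_repr q).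
have [k ->] := zZ (repr q).2; exists ((repr q).1 * phi k)%g.
rewrite [RHS]ind_actE mulg1; apply/ind_piP; exists k^-1%g.
by rewrite -mulgA -gmulfM mulgV gmulf1 mulg1 gactK.
Qed.

Lemma ext_transitive (K L : finGroupType) (X : gset K) (Y : gset L) :
  gtransitive X -> gtransitive Y -> gtransitive (gset_ext X Y).
Proof.
case=> x xX [y yY]; exists (x, y) => -[x' y'].
by have [g ->] := xX x'; have [h ->] := yY y'; exists (g, h).
Qed.

Section StarPower.

Variables (n i j : nat) (e : n = (i + j)%N) (X Y : gset G).

Definition juxt (u : gset_pow i X) (v : gset_pow j Y) :
    gset_pow n (gset_sum X Y) :=
  [ffun k => match split (cast_ord e k) with
     | inl a => inl (u a)
     | inr b => inr (v b)
     end].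

Lemma juxt_act (k : wreath G i * wreath G j) u v :
  juxt (gact k.1 u) (gact k.2 v) = gact (wr_embed e k) (juxt u v).
Proof.
apply/ffunP=> a; rewrite !ffunE /= blk_permV permE /blk_fun cast_ordKV.
by case: (split_ordP (cast_ord e a)) => b _;
  rewrite ?(unsplitK (inl _)) ?(unsplitK (inr _)) /= ffunE.
Qed.

Lemma juxtl u v a : juxt u v (cast_ord (esym e) (lshift j a)) = inl (u a).
Proof. by rewrite ffunE cast_ordKV (unsplitK (inl _)). Qed.

Lemma juxtr u v b : juxt u v (cast_ord (esym e) (rshift i b)) = inr (v b).
Proof. by rewrite ffunE cast_ordKV (unsplitK (inr _)). Qed.

Lemma juxt_inj u v u' v' : juxt u v = juxt u' v' -> u = u' /\ v = v'.
Proof.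
move=> E; split; apply/ffunP=> a.
  by move: (juxtl u v a); rewrite E juxtl => -[].
by move: (juxtr u v a); rewrite E juxtr => -[].
Qed.

(** The letters inl and inr record which coordinates come from u and which from
    v, so the permutation underlying x preserves the two blocks; its
    restrictions to them, with the entries of x, give the element k. *)
Lemma juxt_stab (x : wreath G n) u v u' v' :
  gact x (juxt u v) = juxt u' v' -> exists k, x = wr_embed e k.
Proof.
move=> /ffunP E.
pose L a : 'I_n := cast_ord (esym e) (lshift j a).
pose R b : 'I_n := cast_ord (esym e) (rshift i b).
have LI : injective L by move=> a b /cast_ord_inj/lshift_inj.
have RI : injective R by move=> a b /cast_ord_inj/rshift_inj.
have LR c : (exists a, c = L a) \/ (exists b, c = R b).
  by rewrite -[c](cast_ordK e); case: (split_ordP (cast_ord e c)) => a ->;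
    [left | right]; exists a.
have sP a : exists a', x.2^-1%g (L a) = L a'.
  have := E (L a); rewrite juxtl ffunE.
  by case: (LR (x.2^-1%g (L a))) => [//|[b ->]]; rewrite juxtr.
have tP b : exists b', x.2^-1%g (R b) = R b'.
  have := E (R b); rewrite juxtr ffunE.
  by case: (LR (x.2^-1%g (R b))) => [[a ->]|//]; rewrite juxtl.
have [s sE] := boolp.choice sP; have [t tE] := boolp.choice tP.
have sI : injective s by move=> a b /(congr1 L); rewrite -!sE => /perm_inj/LI.
have tI : injective t by move=> a b /(congr1 R); rewrite -!tE => /perm_inj/RI.
(* s and t restrict the inverse of x.2, hence the inverses here. *)
exists (([ffun a => x.1 (L a)], (perm sI)^-1%g),
        ([ffun b => x.1 (R b)], (perm tI)^-1%g)).
rewrite [LHS]surjective_pairing /wr_embed /=; congr (_, _).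
  apply/ffunP=> c; rewrite ffunE.
  case: (split_ordP (cast_ord e c)) => a Ea; rewrite ffunE; congr (x.1 _);
    by apply: (can_inj (cast_ordK e)); rewrite cast_ordKV.
rewrite -blk_permV; apply: invg_inj; rewrite invgK; apply/permP=> c.
rewrite [RHS]permE /blk_fun -[c in LHS](cast_ordK e).
case: (split_ordP (cast_ord e c)) => a ->.
  by rewrite (permE sI); apply: sE.
by rewrite (permE tI); apply: tE.
Qed.

(** The class of (g, (u, v)) is sent to the image under g of the juxtaposition
    of u and v; this is injective because of juxt_stab. *)
Lemma star_embed (O1 : gset (wreath G i)) (O2 : gset (wreath G j)) :
  gembed O1 (gset_pow i X) -> gembed O2 (gset_pow j Y) ->
  gembed (gset_star e O1 O2) (gset_pow n (gset_sum X Y)).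
Proof.
case=> f [fI fJ] [h [hI hJ]].
pose F (g : wreath G n) (z : gset_ext O1 O2) :=
  gact g (juxt (f z.1) (h z.2)).
have FK g k z : F (g * wr_embed e k)%g z = F g (gact k z).
  by rewrite /F gactM -juxt_act -fJ -hJ.
have F_pi g z : F (repr (ind_pi (wr_embed e) g z)).1
                  (repr (ind_pi (wr_embed e) g z)).2 = F g z.
  move: (ind_pi_repr (ind_pi (wr_embed e) g z)).
  by case: (repr _) => g' z' /= /ind_piP[k [-> ->]]; rewrite FK.
exists (fun q : gset_star e O1 O2 => F (repr q).1 (repr q).2).
split; last first.
  by move=> g q; rewrite -[q]ind_pi_repr /= ind_actE !F_pi /F gactM.
move=> p q; rewrite -[p]ind_pi_repr -[q]ind_pi_repr !F_pi.
move: (repr p) (repr q) => [g z] [g' z'] /= E.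
have E' : gact (g'^-1 * g)%g (juxt (f z.1) (h z.2)) = juxt (f z'.1) (h z'.2).
  by rewrite gactM [gact g _]E gactK.
have [k kE] := juxt_stab E'.
move: E'; rewrite kE -juxt_act -fJ -hJ => /juxt_inj[/fI E1 /hI E2].
apply/ind_piP; exists k; split.
  by rewrite -[RHS]/(g' * wr_embed e k)%g -kE mulKVg.
by rewrite [z']surjective_pairing -E1 -E2.
Qed.

End StarPower.

Lemma star_power_orbits n i j (e : n = (i + j)%N) b c :
  power_orbits i b -> power_orbits j c -> power_orbits n (star e b c).
Proof.
move=> [X [O1 [tO1 OX ->]]] [Y [O2 [tO2 OY ->]]].
exists (gset_sum X Y), (gset_star e O1 O2); split.
- exact/ind_transitive/ext_transitive.
- exact: star_embed.
- exact: star_bcls.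
Qed.

Lemma star_zspan n i j (e : n = (i + j)%N) x y :
  zspan (power_orbits i) x -> zspan (power_orbits j) y ->
  zspan (power_orbits n) (star e x y).
Proof.
apply: zspan_bilin; [exact: starDl | exact: starDr |].
by move=> b c Hb Hc; apply/zspan_mem/star_power_orbits.
Qed.

(** G wr Sigma_0 is trivial and 1 is the class of a point, so the induction is
    along an isomorphism. *)
Lemma star1 n (e : n = (0 + n)%N) (y : burnside (wreath G n)) : star e 1 y = y.
Proof.
have wrE (g : wreath G n) : wr_embed e (1%g, g) = g.
  rewrite [RHS]surjective_pairing /wr_embed; congr (_, _) => /=.
    apply/ffunP=> c; rewrite ffunE.
    case: (split_ordP (cast_ord e c)) => [[]//|a Ea]; congr (g.1 _).
    exact/val_inj/esym/(congr1 val Ea).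
  apply/permP=> c; rewrite permE /blk_fun.
  case: (split_ordP (cast_ord e c)) => [[]//|a Ea].
  apply: val_inj => /=; rewrite add0n; congr (val (g.2 _)).
  exact/val_inj/esym/(congr1 val Ea).
have star1b (Y : gset (wreath G n)) : star e 1 (bcls Y) = bcls Y.
  rewrite -[LHS]/(star e (bcls (gset1 (wreath G 0))) (bcls Y)) star_bcls.
  apply: bcls_iso.
  apply: (@ind_giso _ _ _ _ Y (fun g (z : gset_ext (gset1 (wreath G 0)) Y) =>
    gact g z.2)).
  - by move=> g h z; rewrite gactM.
  - by move=> w; exists (1%g, (tt, w)); rewrite gact1.
  - move=> g [[] z] g' [[] z'] /=; split=> [E|/ind_piP[[k1 k] [-> [->]]]].
      apply/ind_piP; exists (1%g, (g'^-1 * g)%g); split.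
        by rewrite -[RHS]/(g' * wr_embed e _)%g wrE mulKVg.
      by congr (_, _); rewrite /= gactM E gactK.
    have -> : k1 = 1%g.
      by apply: injective_projections; [apply/ffunP=> -[] | apply/permP=> -[]].
    by rewrite -[X in gact X z]/(g' * wr_embed e _)%g wrE gactM.
have starD := @starDr _ _ _ _ e 1.
elim/bcls_ind: y => Y Z; apply: (addIr (bcls Z)); rewrite subrK.
by rewrite -{2}(star1b Z) -starD subrK star1b.
Qed.

Lemma bcls_pow_zspan n (X : gset G) :
  zspan (power_orbits n) (bcls (gset_pow n X)).
Proof. by apply: zspan_sub (bcls_orbits _) => b [O [? ? ->]]; exists X, O. Qed.

(** The values at -[Y] are solved for in the addition formula at Y + (-Y) = 0,
    where P_n(0) is the class of the n-th power of the empty set. *)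
Lemma power_zspan (P : forall m, burnside G -> burnside (wreath G m)) n x :
  total_power P -> zspan (power_orbits n) (P n x).
Proof.
case=> Pb P0 PD.
have PN m Y : zspan (power_orbits m) (P m (- bcls Y)).
  have [k] := ubnP m; elim: k => // k IH in m *; rewrite ltnS => mk.
  (* The index m - 0 of the first term is not convertible to m, hence the
     equation on p. *)
  have head p (e : m = (0 + p)%N) z :
      star e (P 0 (bcls Y)) (P p z) = P m z.
    by have E : p = m := esym e; subst p; rewrite P0 star1.
  have := PD m (bcls Y) (- bcls Y); rewrite subrr.
  rewrite big_ord_recl /= head => /esym/(canRL (addrK _)) ->.
  apply: zspanB; first by rewrite -bcls0 Pb; apply: bcls_pow_zspan.
  apply: zspan_sum => a _; apply: star_zspan.
    by rewrite Pb; apply: bcls_pow_zspan.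
  apply: IH; apply: leq_trans mk.
  by rewrite /= /bump /= add1n subnS prednK ?subn_gt0 // leq_subr.
elim/bcls_ind: x => X Y; rewrite PD; apply: zspan_sum => a _.
by apply: star_zspan => //; rewrite Pb; apply: bcls_pow_zspan.
Qed.

(** The right-hand side is one of the sets that are intersected on the left, and
    the span of each of those sets contains the classes of the powers X^n. *)
Lemma basis_support_power
    (P : forall m, burnside G -> burnside (wreath G m)) n :
  total_power P -> basis_support (P n) = power_orbits n.
Proof.
move=> hP; apply/seteqP; split=> [b|b [X [O [tO OX ->]]] S [Sb PS]].
  apply; split=> [c [X [O [tO _ ->]]]|_ [x _ <-]]; first by exists O.
  exact: power_zspan.
have [Pb _ _] := hP; apply: span_orbit Sb _ tO OX.
by rewrite -Pb; apply: PS; exists (bcls X).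
Qed.

End PowerOrbits.

Theorem proposition3p5 (G : finGroupType)
    (P : forall m, burnside G -> burnside (wreath G m)) (hP : total_power P)
    (n i j : nat) (e : n = (i + j)%N)
    (x : burnside (wreath G i)) (y : burnside (wreath G j)) :
  Aring P i x -> Aring P j y -> Aring P n (star e x y).
Proof.
rewrite /Aring !basis_support_power //; exact: star_zspan.
Qed.
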